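(* For all integers $n \geq m \geq 0$, $$r(S(n,m)) \geq \frac{5}{6}m+\frac{5}{3}n + o(m).$$ Further, for $n \geq 2m$, $$r(S(n,m)) \geq \frac{21}{23}m+ \frac{189}{115}n + o(m).$$ Here $o(m)$ denotes a term whose ratio to $m$ tends to $0$ as $m \to \infty$.
   Context: For integers $n \geq m \geq 0$, the double star $S(n,m)$ is the graph consisting of the union of two stars $K_{1,n}$ and $K_{1,m}$ together with an edge (the bridge) joining the centers of these two stars. For a graph $G$, the Ramsey number $r(G)$ is the least integer $N$ such that every 2-coloring of the edges of the complete graph $K_N$ contains a monochromatic copy of $G$. *)

(* Defs.v *)
From mathcomp Require Import all_boot.

Set Implicit Arguments.
Unset Strict Implicit.
Unset Printing Implicit Defensive.

Record sgraph := SGraph {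
  vertex :> finType;
  edge : rel vertex;
  edge_sym : symmetric edge;
  edge_irr : irreflexive edge
}.

(* K_{1,n}: the centre is None, the leaves are Some i. *)
Definition star_edge (n : nat) : rel (option 'I_n) :=
  fun x y => isSome x (+) isSome y.

(* S(n,m): the disjoint union of K_{1,n} and K_{1,m}, plus the edge joining
   the two centres. *)
Definition double_star_edge (n m : nat) : rel (option 'I_n + option 'I_m) :=
  fun u v =>
    match u, v with
    | inl x, inl y => star_edge x y
    | inr x, inr y => star_edge x y
    | inl x, inr y => (x == None) && (y == None)
    | inr x, inl y => (x == None) && (y == None)
    end.

Lemma double_star_sym n m : symmetric (@double_star_edge n m).
Proof. by case=> x [] y; rewrite /= /star_edge 1?addbC 1?andbC. Qed.

Lemma double_star_irr n m : irreflexive (@double_star_edge n m).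
Proof. by case=> x; rewrite /= /star_edge addbb. Qed.

Definition double_star (n m : nat) : sgraph :=
  SGraph (@double_star_sym n m) (@double_star_irr n m).

(* The edges of K_N are the 2-subsets of 'I_N; the values of a colouring on the
   other subsets are irrelevant, since f is injective and edge is irreflexive. *)
Definition mono_copy (N : nat) (G : sgraph) (c : {ffun {set 'I_N} -> bool}) :
    bool :=
  [exists b : bool, exists f : {ffun G -> 'I_N},
     injectiveb f &&
     [forall x, forall y, edge x y ==> (c [set f x; f y] == b)]].

Definition arrows (N : nat) (G : sgraph) : bool :=
  [forall c : {ffun {set 'I_N} -> bool}, mono_copy G c].

Definition mono_set (T : finType) (c : {set T} -> bool) (b : bool)
    (B : {set T}) : Prop :=
  {in B &, forall x y, x != y -> c [set x; y] = b}.

Lemma ramsey_sets (T : finType) (c : {set T} -> bool) (s : nat) :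
  forall (k : bool -> nat) (A : {set T}),
    k true + k false = s -> 2 ^ s <= #|A| ->
  exists b, exists2 B : {set T}, B \subset A & #|B| = k b /\ mono_set c b B.
Proof.
elim: s => [|s IHs] k A ks sA.
  exists true, set0; rewrite ?sub0set // cards0; split; last first.
    by move=> x y; rewrite inE.
  by move/eqP: ks; rewrite addn_eq0 => /andP[/eqP].
case: (boolP [exists b, k b == 0]) => [/existsP[b /eqP kb]|].
  exists b, set0; rewrite ?sub0set // cards0; split=> // x y.
  by rewrite inE.
rewrite negb_exists => /forallP k_gt0.
have /card_gt0P[v vA] : 0 < #|A| by apply: leq_trans sA; rewrite expn_gt0.
pose C b := [set x in A :\ v | c [set v; x] == b].
have [b sC] : exists b, 2 ^ s <= #|C b|.
  have cardC : #|A| = (#|C true| + #|C false|).+1.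
    rewrite (cardsD1 v) vA add1n -(cardsID [set x | c [set v; x]] (A :\ v)).
    congr (_ + _).+1; apply: eq_card => x; rewrite !inE.
      by case: (c _); rewrite ?andbT ?andbF.
    by case: (c _); rewrite ?andbT ?andbF.
  move: sA; rewrite cardC expnS mul2n -addnn => sA.
  case: (leqP (2 ^ s) #|C true|) => [|lt1]; first by exists true.
  case: (leqP (2 ^ s) #|C false|) => [|lt2]; first by exists false.
  have := leq_add lt1 lt2; rewrite addSn addnS => lt3.
  by have := leq_trans lt3 sA; rewrite ltnn.
pose k' b' := if b' == b then (k b').-1 else k b'.
have k's : k' true + k' false = s.
  apply: succn_inj; rewrite -ks /k'; have := k_gt0 b; rewrite -lt0n.
  by case: (b) => /= /prednK kb; [rewrite -addSn kb | rewrite -addnS kb].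
have [b' [B BC [cardB mB]]] := IHs k' (C b) k's sC.
have BA : B \subset A.
  by apply: subset_trans BC _; apply/subsetP=> x; rewrite !inE => /andP[/andP[]].
case: (eqVneq b' b) => [eb|nb]; last first.
  by exists b', B => //; split=> //; rewrite cardB /k' (negPf nb).
have BP x : x \in B -> x != v /\ c [set v; x] = b.
  by move=> /(subsetP BC); rewrite !inE => /andP[/andP[-> _] /eqP].
have vB : v \notin B by apply/negP=> /BP[]; rewrite eqxx.
exists b', (v |: B); first by rewrite subUset sub1set vA.
split.
  by rewrite cardsU1 vB cardB /k' eb eqxx add1n prednK // lt0n.
move=> x y /setU1P[->|xB] /setU1P[->|yB] nxy; rewrite ?eqxx // in nxy *.
- by rewrite eb; have [] := BP y yB.
- by rewrite setUC eb; have [] := BP x xB.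
- exact: mB.
Qed.

Lemma arrows_exists (G : sgraph) : exists N, arrows N G.
Proof.
exists (2 ^ (#|G| + #|G|)); apply/forallP=> c.
have [|b [B _ [cardB mB]]] :=
  @ramsey_sets _ c _ (fun=> #|G|) [set: 'I_(2 ^ (#|G| + #|G|))] erefl.
  by rewrite cardsT card_ord.
apply/existsP; exists b; apply/existsP.
pose f x := enum_val (cast_ord (esym cardB) (enum_rank x)).
have f_inj : injective f.
  by move=> x y /enum_val_inj /cast_ord_inj /enum_rank_inj.
exists (finfun f); apply/andP; split.
  by apply/injectiveP=> x y; rewrite !ffunE => /f_inj.
apply/forallP=> x; apply/forallP=> y; apply/implyP=> exy; rewrite !ffunE.
apply/eqP/mB; rewrite ?enum_valP // (inj_eq f_inj).
by apply: contraTneq exy => ->; rewrite edge_irr.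
Qed.

Definition ramsey (G : sgraph) : nat := ex_minn (arrows_exists G).

(* Main.v *)
(** A lower bound needs a blue graph H on a vertex set T with degrees at most n
    (so no blue S(n,m)), in which any two nonadjacent vertices have at least
    #|T| - (n + m + 1) common neighbours: the red neighbourhoods of the two ends
    of a red edge then cannot cover the n + m + 2 vertices of a red S(n,m).
    Take H to be a blow-up of a strongly regular graph P (parts of size t,
    complete bipartite graphs along the edges of P), and put an s-regular
    bipartite graph between any two parts that are nonadjacent in P.  The
    pentagon gives the first bound and the Kneser graph K(7,2) the second; in
    both cases t is linear in n and m, s is the largest value allowed by the
    degree condition, and the error term is a constant. *)

Require Import Defs.
From mathcomp Require Import all_boot all_order all_algebra.
From mathcomp Require Import all_classical all_reals all_analysis.
From mathcomp Require Import zify lra.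
Import Order.TTheory GRing.Theory Num.Theory.
Import numFieldNormedType.Exports.
Import boot.fintype boot.finset.

Set Implicit Arguments.
Unset Strict Implicit.
Unset Printing Implicit Defensive.

(** * From degree and codegree conditions to a Ramsey lower bound *)

Lemma ramsey_gt_card (T : finType) (H : rel T) (n m : nat) :
    symmetric H -> irreflexive H ->
    (forall u, #|[pred z | H u z]| <= n) ->
    (forall u v, u != v -> ~~ H u v ->
       #|T| <= #|[pred z | H u z && H v z]| + (n + m).+1) ->
  #|T| < ramsey (double_star n m).
Proof.
move=> Hsym Hirr Hdeg Hcodeg; rewrite /ramsey; case: ex_minnP => N arrN _.
rewrite ltnNge; apply: contraL arrN => leNT.
(* If [N <= #|T|], then K_N embeds in [T] and inherits its colouring: [true] (blue) on the edges of
   [H], [false] (red) elsewhere. *)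
pose g (i : 'I_N) := enum_val (widen_ord leNT i) : T.
have g_inj : injective g by move=> i j /enum_val_inj[] /val_inj.
pose c := [ffun A : {set 'I_N} =>
  [exists x in A, exists y in A, H (g x) (g y)]].
have cE x y : c [set x; y] = H (g x) (g y).
  rewrite ffunE; apply/existsP/idP => [[a]|Hxy]; last first.
    by exists x; rewrite set21; apply/existsP; exists y; rewrite set22.
  case/andP=> Aa /existsP[b /andP[Ab]].
  by case/set2P: Aa => ->; case/set2P: Ab => ->; rewrite ?Hirr // Hsym.
apply/forallPn; exists c; apply/existsP=> -[col /existsP[f]].
case/andP=> /injectiveP f_inj /forallP f_edge.
pose h x := g (f x).
have h_inj : injective h by move=> x y /g_inj/f_inj.
have h_edge x y : double_star_edge x y -> H (h x) (h y) = col.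
  by move=> exy; have /forallP/(_ y)/implyP/(_ exy)/eqP := f_edge x; rewrite cE.
set u := h (inl None); set v := h (inr None).
have uv : H u v = col by apply: h_edge.
case: col h_edge uv {f_edge} => h_edge uv.
  (* Blue copy: the n leaves at [u] together with [v] give [u] degree at least n + 1. *)
  pose k (o : option 'I_n) := h (if o is Some i then inl (Some i) else inr None).
  have k_inj : injective k by move=> [i|] [j|] // /h_inj // [->].
  have : #|codom k| <= #|[pred z | H u z]|.
    apply/subset_leq_card/subsetP => _ /codomP[[i|] ->]; rewrite inE //.
    exact: h_edge.
  rewrite card_codom // card_option card_ord => /leq_trans/(_ (Hdeg u)).
  by rewrite ltnn.
have u_neq_v : u != v by apply/eqP => /h_inj.
have := Hcodeg u v u_neq_v; rewrite uv => /(_ isT).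
(* Red copy: each of its n + m + 2 vertices is a red neighbour of [u] or of [v], so none is a common
   blue neighbour. *)
have : #|codom h| <= #|[predC [pred z | H u z && H v z]]|.
  apply/subset_leq_card/subsetP => _ /codomP[[[i|]|[i|]] ->]; rewrite !inE /=.
  - by rewrite h_edge.
  - by rewrite Hirr.
  - by rewrite andbC h_edge.
  - by rewrite Hirr andbF.
rewrite card_codom // card_sum !card_option !card_ord.
rewrite -(cardC [pred z | H u z && H v z]) leq_add2l => /leq_trans H1 /H1.
by rewrite addSn addnS ltnn.
Qed.

(** * Blow-ups and their codegrees *)

Lemma card_shift_lt (t s : nat) (i : 'I_t) :
  s <= t -> \sum_(j < t) ((i + j) %% t < s) = s.
Proof.
case: t i => [[]//|t] i le_st.
transitivity (\sum_(j < t.+1) (j < s : nat)).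
  by rewrite [RHS](reindex_inj (@GRing.addrI _ i)).
by rewrite -big_mkcond -(big_ord_widen _ (fun=> 1)) // sum1_card card_ord.
Qed.

(** Taking the sum of the two indices, not their difference, makes the s-regular bipartite graph
    symmetric. *)
Definition blowup (T : finType) (e : rel T) (t s : nat) : rel (T * 'I_t) :=
  fun u v => e u.1 v.1 || ((u.1 != v.1) && ((u.2 + v.2) %% t < s)).

Lemma card_pair_sum (T : finType) (t : nat) (P : pred (T * 'I_t)) :
  #|P| = \sum_c \sum_(j < t) P (c, j).
Proof.
rewrite -sum1_card big_mkcond pair_bigA /=; apply: eq_bigr => -[c j] _ /=.
by rewrite unfold_in; case: (P _).
Qed.

Lemma card_sum_pred (T : finType) (P : pred T) : #|P| = \sum_c P c.
Proof.
by rewrite -sum1_card big_mkcond; apply: eq_bigr => c _; rewrite unfold_in; case: (P c).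
Qed.

Section Blowup.
Variables (T : finType) (e : rel T) (k mu t s : nat).
Hypotheses (e_sym : symmetric e) (e_irr : irreflexive e).
Hypothesis e_deg : forall a, #|[pred c | e a c]| = k.
Hypothesis e_codeg :
  forall a b, a != b -> ~~ e a b -> #|[pred c | e a c && e b c]| = mu.
Hypothesis s_le_t : s <= t.

Lemma blowup_sym : symmetric (@blowup T e t s).
Proof. by move=> u v; rewrite /blowup e_sym eq_sym addnC. Qed.

Lemma blowup_irr : irreflexive (@blowup T e t s).
Proof. by move=> u; rewrite /blowup e_irr eqxx. Qed.

(* Equalities and bounds below move negative terms across to avoid truncated
   subtraction: the degree is k t + (#|T| - 1 - k) s, and the codegree is at
   least mu t + 2 (k - mu) s for vertices in nonadjacent parts. *)
Lemma blowup_deg u :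
  #|[pred z | @blowup T e t s u z]| + s * k = t * k + s * #|T|.-1.
Proof.
rewrite card_pair_sum -(e_deg u.1) card_sum_pred.
have -> : #|T|.-1 = \sum_c (u.1 != c).
  by rewrite -(cardC1 u.1) card_sum_pred; apply: eq_bigr => c _; rewrite /= eq_sym.
rewrite !big_distrr /= -!big_split /=; apply: eq_bigr => c _.
rewrite /blowup /=; case: (boolP (e u.1 c)) => [euc|_].
  have -> : u.1 != c by apply: contraTneq euc => <-; rewrite e_irr.
  by rewrite sum_nat_const card_ord.
case: (u.1 != c) => /=; first by rewrite card_shift_lt // !muln0 muln1 add0n addn0.
by rewrite big1 // !muln0.
Qed.

Lemma blowup_codeg u v : u.1 != v.1 -> ~~ e u.1 v.1 ->
  t * mu + s * k + s * k <=
    #|[pred z | @blowup T e t s u z && @blowup T e t s v z]| + 2 * s * mu.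
Proof.
move=> uv euv; rewrite card_pair_sum -(e_codeg uv euv).
rewrite -{1}(e_deg u.1) -(e_deg v.1) !card_sum_pred.
rewrite !big_distrr /= -!big_split /=; apply: leq_sum => c _.
rewrite /blowup /=.
case: (boolP (e u.1 c)) => [euc|_]; case: (boolP (e v.1 c)) => [evc|_] /=.
- rewrite sum_nat_const card_ord; lia.
(* A part adjacent to only one of [u.1], [v.1] differs from the other, as these two are nonadjacent;
   it contributes [s]. *)
- have -> : v.1 != c by apply: contraNneq euv => ->.
  rewrite /= card_shift_lt //; lia.
- have -> : u.1 != c by apply: contraNneq euv => ->; rewrite e_sym.
  under eq_bigr do rewrite andbT.
  rewrite /= card_shift_lt //; lia.
(* Parts adjacent to neither are bounded below by 0, so overlaps of two shifts need no count. *)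
- lia.
Qed.

Lemma blowup_codeg_same u v : u.1 = v.1 ->
  t * k <= #|[pred z | @blowup T e t s u z && @blowup T e t s v z]|.
Proof.
move=> uv; rewrite card_pair_sum -(e_deg u.1) card_sum_pred big_distrr /=.
apply: leq_sum => c _; rewrite /blowup /= -uv; case: (e u.1 c) => /=; last by lia.
by rewrite sum_nat_const card_ord.
Qed.

(** The three conditions handle, in order, degrees, two vertices of one part, and vertices in
    nonadjacent parts. *)
Lemma ramsey_gt_blowup (n m : nat) :
    t * k + s * #|T|.-1 <= n + s * k ->
    #|T| * t <= t * k + (n + m).+1 ->
    #|T| * t + 2 * s * mu <= t * mu + 2 * s * k + (n + m).+1 ->
  #|T| * t < ramsey (double_star n m).
Proof.
move=> le_deg le_same le_codeg.
have cardTt : #|{: T * 'I_t}| = #|T| * t by rewrite card_prod card_ord.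
rewrite -cardTt.
apply: (ramsey_gt_card blowup_sym blowup_irr) => [u|u v _ nuv].
  by rewrite -(leq_add2r (s * k)) blowup_deg.
rewrite cardTt; have [uv|uv] := eqVneq u.1 v.1.
  by apply: leq_trans le_same _; rewrite leq_add2r blowup_codeg_same.
have /(blowup_codeg uv) : ~~ e u.1 v.1 by move: nuv; rewrite /blowup; case: (e _ _).
move=> le_common; rewrite -(leq_add2r (2 * s * mu)); apply: leq_trans le_codeg _.
rewrite [leqRHS]addnAC leq_add2r; apply: leq_trans le_common.
by rewrite -mulnA mul2n -addnn addnA.
Qed.

End Blowup.

(** * The pentagon and the first bound *)

Definition pentagon_edge : rel 'I_5 :=
  fun i j => (j == (i.+1 %% 5) :> nat) || (i == (j.+1 %% 5) :> nat).

Lemma pentagon_sym : symmetric pentagon_edge.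
Proof. by move=> i j; rewrite /pentagon_edge orbC. Qed.

Lemma pentagon_irr : irreflexive pentagon_edge.
Proof. by case=> [[|[|[|[|[|]]]]]]. Qed.

Lemma pentagon_deg i : #|[pred j | pentagon_edge i j]| = 2.
Proof.
rewrite card_sum_pred !big_ord_recl big_ord0.
by case: i => [[|[|[|[|[|]]]]]].
Qed.

Lemma pentagon_codeg i j : i != j -> ~~ pentagon_edge i j ->
  #|[pred c | pentagon_edge i c && pentagon_edge j c]| = 1.
Proof.
rewrite card_sum_pred !big_ord_recl big_ord0.
by case: i => [[|[|[|[|[|]]]]]] // ?; case: j => [[|[|[|[|[|]]]]]].
Qed.

Lemma ramsey_pentagon_bound (n m : nat) :
  m <= n -> 5 * m + 10 * n <= 6 * ramsey (double_star n m) + 24.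
Proof.
(* The degree condition is 2 (t + s) <= n; putting s = n/2 - t into 4 t <= 2 s + n + m + 1 leaves 6
   t <= 2 n + m, up to rounding. Here m <= n ensures t <= n/2. *)
move=> le_mn; pose t := (2 * n + m) %/ 6; pose s := minn (n %/ 2 - t) t.
have := @ramsey_gt_blowup _ _ 2 1 t s pentagon_sym pentagon_irr pentagon_deg
  pentagon_codeg (geq_minr _ _) n m.
rewrite card_ord /= => H; suff: 5 * t < ramsey (double_star n m) by lia.
by apply: H; lia.
Qed.

(** * The Kneser graph K(7,2) and the second bound *)

Definition kneser_vertex := {A : {set 'I_7} | #|A| == 2}.
Definition kneser_edge : rel kneser_vertex := fun A B => [disjoint val A & val B].

Lemma card_kneser_vertex : #|{: kneser_vertex}| = 21.
Proof.
rewrite card_sig -[RHS]/('C(7, 2)) -[X in 'C(X, _)]card_ord -card_draws cardsE.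
by apply: eq_card => A; rewrite !inE.
Qed.

Lemma kneser_sym : symmetric kneser_edge.
Proof. by move=> A B; rewrite /kneser_edge disjoint_sym. Qed.

Lemma kneser_irr : irreflexive kneser_edge.
Proof.
move=> [A /= cA]; rewrite /kneser_edge /= -setI_eq0 setIid -cards_eq0.
by rewrite (eqP cA).
Qed.

(** Serves both counts below: (common) neighbours are the pairs inside a complement. *)
Lemma card_kneser_sub (B : {set 'I_7}) :
  #|[pred C : kneser_vertex | val C \subset B]| = 'C(#|B|, 2).
Proof.
rewrite -cards_draws -[LHS](card_imset _ val_inj) /=.
apply: eq_card => A; rewrite !inE; apply/imsetP/andP.
  by case=> C; rewrite inE => sub ->; rewrite (valP C).
by case=> sub cA; exists (exist _ A cA).
Qed.

Lemma kneser_deg A : #|[pred C | kneser_edge A C]| = 10.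
Proof.
have cD : #|~: val A| = 5 by rewrite cardsCs setCK (eqP (valP A)) card_ord.
rewrite -[RHS]/('C(5, 2)) -[in RHS]cD -card_kneser_sub; apply: eq_card => C.
by rewrite !inE -disjoints_subset disjoint_sym.
Qed.

Lemma kneser_codeg A B : A != B -> ~~ kneser_edge A B ->
  #|[pred C | kneser_edge A C && kneser_edge B C]| = 6.
Proof.
move=> neqAB nAB.
have cA := eqP (valP A); have cB := eqP (valP B).
(* Two distinct pairs that intersect share one point, so their union misses 4 of the 7 points. *)
have cI : #|val A :&: val B| = 1.
  apply/eqP; rewrite eqn_leq lt0n cards_eq0 setI_eq0 nAB andbT leqNgt.
  apply: contra neqAB => gt1; apply/eqP/val_inj.
  have eqI (D : {set 'I_7}) : #|D| = 2 -> val A :&: val B \subset D ->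
      val A :&: val B = D.
    by move=> cD sub; apply/eqP; rewrite eqEcard sub cD.
  by rewrite -(eqI _ cA (subsetIl _ _)); apply: eqI cB (subsetIr _ _).
have cD : #|~: (val A :|: val B)| = 4.
  by rewrite cardsCs setCK cardsU cA cB cI card_ord.
rewrite -[RHS]/('C(4, 2)) -[in RHS]cD -card_kneser_sub; apply: eq_card => C.
rewrite !inE setCU subsetI -!disjoints_subset /kneser_edge.
by rewrite ![[disjoint val C & _]]disjoint_sym.
Qed.

(** With s = n/10 - t from the degree condition, 15 t <= 8 s + n + m + 1 becomes about 23 t <= m + 9
    n/5. The hypothesis 2 m <= n ensures t <= n/10. *)
Lemma ramsey_kneser_bound (n m : nat) :
  2 * m <= n -> 105 * m + 189 * n <= 115 * ramsey (double_star n m) + 4830.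
Proof.
(* Subtracting 1 from t absorbs the rounding in n %/ 10. *)
move=> le_mn; pose t := (5 * m + 9 * n) %/ 115 - 1; pose s := minn (n %/ 10 - t) t.
have := @ramsey_gt_blowup _ _ 10 6 t s kneser_sym kneser_irr kneser_deg
  kneser_codeg (geq_minr _ _) n m.
rewrite card_kneser_vertex /= => H; suff: 21 * t < ramsey (double_star n m) by lia.
by apply: H; lia.
Qed.

(** * Constant error terms are o(m) *)

Section Asymptotics.
Local Open Scope classical_set_scope.
Local Open Scope ring_scope.

Lemma cvg_cst_div_nat (R : realType) (c : R) :
  (fun m : nat => c / m%:R) @ \oo --> (0 : R).
Proof.
rewrite -(mulr0 c); apply: cvgM; first exact: cvg_cst.
apply/gtr0_cvgV0; last exact: cvgr_idn.
by near=> m; rewrite ltr0n; near: m; exact: nbhs_infty_gt.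
Unshelve. all: by end_near. Qed.

End Asymptotics.

Local Open Scope classical_set_scope.
Local Open Scope ring_scope.

Theorem theorem1p3 (R : realType) :
  (exists f : nat -> R,
     ((fun m : nat => f m / m%:R) @ \oo --> (0 : R)) /\
     (forall n m : nat, (m <= n)%N ->
        (ramsey (double_star n m))%:R >=
          5 / 6 * m%:R + 5 / 3 * n%:R + f m :> R)) /\
  (exists g : nat -> R,
     ((fun m : nat => g m / m%:R) @ \oo --> (0 : R)) /\
     (forall n m : nat, (2 * m <= n)%N ->
        (ramsey (double_star n m))%:R >=
          21 / 23 * m%:R + 189 / 115 * n%:R + g m :> R)).
Proof.
split.
  (* 4 = 24 / 6. *)
  exists (fun=> - 4); split=> [|n m le_mn]; first exact: cvg_cst_div_nat.
  have := ramsey_pentagon_bound le_mn.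
  by rewrite -(ler_nat R) 2!natrD !natrM; lra.
(* 42 = 4830 / 115. *)
exists (fun=> - 42); split=> [|n m le_mn]; first exact: cvg_cst_div_nat.
have := ramsey_kneser_bound le_mn.
by rewrite -(ler_nat R) 2!natrD !natrM; lra.
Qed.
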